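(* Let $\epsilon>0$ be any constant for which the following holds: for any set of edges $F\subseteq\binom{[n]}{2}$, the probability that $\mathcal{G}_m$ holds and $F\subseteq E(m)$ is at most $(pn^{2\epsilon})^{|F|}$. Suppose $\ell\ge1$ and that $\mathcal{S}$ is a family of $\ell$-element subsets of $\binom{[n]}{2}$. Set $\mu':=|\mathcal{S}|p^{\ell}n^{2\ell\epsilon}$ and say that a graph $G$ contains $\alpha\in\mathcal{S}$ if all the edges of $\alpha$ are present in $G$. Let $\mathcal{DL}_i(d,k)$ denote the event that there exists a set $\mathcal{I}_0\subseteq\mathcal{S}$ with $|\mathcal{I}_0|\le d$ such that, setting $E_0:=\bigcup_{\alpha\in\mathcal{I}_0}\alpha\subseteq\binom{[n]}{2}$, the graph $G(i)\setminus E_0$ contains at most $\mu'+k$ elements from $\mathcal{S}$. Then for every $d,k>0$ the probability that $\mathcal{G}_m$ holds and $\mathcal{DL}_m(d,k)$ fails is at most $$\left(1+\frac{k}{\mu'}\right)^{-d}\le\exp\left\{-\frac{dk}{\mu'+k}\right\}.$$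
   Context: The $K_4$-free process on $[n]=\{1,\dots,n\}$ starts with the empty graph $G(0)$ and in each step $i+1$ adds an edge $e_{i+1}$ chosen uniformly at random from the set $O(i)$ of open pairs; $G(i)$ is the graph after $i$ steps, with edge set $E(i)$. A pair in $\binom{[n]}{2}\setminus E(i)$ is open (belongs to $O(i)$) if adding it to $G(i)$ creates no copy of $K_4$. $\Gamma_i(v)$ is the neighbourhood of $v$ in $G(i)$. $G(i)\setminus E_0$ is $G(i)$ with the edges in $E_0$ deleted. The notation $x=a\pm b$ means $x\in\{a+yb:-1\le y\le1\}$. Constants and parameters: $W,\epsilon,\mu>0$ are absolute constants, chosen with $W$ sufficiently large and then $\epsilon$ and $\mu$ sufficiently small, such that in particular $W\ge500$, $\epsilon\le1/1000$ and $2W\mu^5\le\epsilon$. Set $p:=n^{-2/5}$, $t_{\max}:=\mu(\log n)^{1/5}$, $m:=n^2pt_{\max}$ (rounded to an integer), $s_e:=n^{1/12-\epsilon}$, $t=t(i):=i/(n^2p)$, $q(t):=e^{-16t^5}$, $f(t):=e^{(t^5+t)W}$. $\mathcal{G}_j$ is the event that for every $0\le i\le j$, in $G(i)$ we have $|O(i)|>0$, and for all distinct $u,v\in[n]$: $|O(i)|=(1\pm3f(t)/s_e)q(t)n^2/2$, $|\Gamma_i(u)|\le3npt_{\max}$ and $|\Gamma_i(u)\cap\Gamma_i(v)|\le(\log n)np^2$. *)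

(* Defs.v *)
From mathcomp Require Import all_boot all_order all_algebra.
From mathcomp Require Import all_classical all_reals all_analysis.
Set Implicit Arguments.
Unset Strict Implicit.
Unset Printing Implicit Defensive.
Import Order.TTheory GRing.Theory Num.Theory.
Local Open Scope ring_scope.

(* The vertex set [n] is 'I_n, a pair is a two-element subset of 'I_n, and a
   graph on [n] is identified with its edge set. *)
Definition vpair (n : nat) := {set 'I_n}.
Definition pairs (n : nat) : {set vpair n} := [set e : {set 'I_n} | #|e| == 2].
Definition graph (n : nat) := {set vpair n}.

Definition spans_K4 (n : nat) (G : graph n) (K : {set 'I_n}) : bool :=
  (#|K| == 4) && [forall e in pairs n, (e \subset K) ==> (e \in G)].

Definition open_pairs (n : nat) (G : graph n) : {set vpair n} :=
  [set e in pairs n :\: G |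
    ~~ [exists K : {set 'I_n}, spans_K4 (e |: G) K && ~~ spans_K4 G K]].

Definition neighbours (n : nat) (G : graph n) (v : 'I_n) : {set 'I_n} :=
  [set u | (u != v) && ([set u; v] \in G)].

(* The first m steps of the process: entry i is [Some e_{i+1}], or [None] when
   no pair is open and the process has terminated. *)
Definition trajectory (n m : nat) := m.-tuple (option (vpair n)).

Definition graph_at (n m : nat) (w : trajectory n m) (i : nat) : graph n :=
  [set e | Some e \in take i w].

Definition step_prob (R : realType) (n : nat) (G : graph n) (x : option (vpair n)) : R :=
  match x with
  | Some e => if e \in open_pairs G then #|open_pairs G|%:R^-1 else 0
  | None => if #|open_pairs G| == 0 then 1 else 0
  end.

Definition trajectory_prob (R : realType) (n m : nat)
    (w : trajectory n m) : R :=
  \prod_(i < m) step_prob R (graph_at w i) (tnth w i).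

Definition Pr (R : realType) (n m : nat) (A : trajectory n m -> Prop) : R :=
  \sum_(w : trajectory n m | `[< A w >]) trajectory_prob R w.

Definition p_ (R : realType) (n : nat) : R := n%:R `^ (- (2 / 5)).
Definition tmax (R : realType) (mu : R) (n : nat) : R :=
  mu * (ln n%:R) `^ (1 / 5).
Definition s_e (R : realType) (eps : R) (n : nat) : R :=
  n%:R `^ (1 / 12 - eps).
Definition time (R : realType) (n i : nat) : R :=
  i%:R / (n%:R ^+ 2 * p_ R n).
Definition q_ (R : realType) (t : R) : R := expR (- (16 * t ^+ 5)).
Definition f_ (R : realType) (W t : R) : R := expR ((t ^+ 5 + t) * W).

(* x = a ± b *)
Definition within (R : realType) (x a b : R) : Prop :=
  exists2 y : R, -1 <= y <= 1 & x = a + y * b.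

Definition good (R : realType) (W eps mu : R) (n m : nat) (j : nat)
    (w : trajectory n m) : Prop :=
  forall i : nat, (i <= j)%N ->
    let G := graph_at w i in
    let t := time R n i in
    (0 < #|open_pairs G|)%N /\
    forall u v : 'I_n, u != v ->
      [/\ exists2 c : R, within c 1 (3 * f_ W t / s_e eps n) &
            #|open_pairs G|%:R = c * q_ t * n%:R ^+ 2 / 2,
          #|neighbours G u|%:R <= 3 * n%:R * p_ R n * tmax mu n &
          #|neighbours G u :&: neighbours G v|%:R
            <= ln n%:R * (n%:R * p_ R n ^+ 2)].

Definition DL (R : realType) (n m : nat) (S : {set {set vpair n}}) (mu' : R)
    (i : nat) (d k : R) (w : trajectory n m) : Prop :=
  exists I0 : {set {set vpair n}},
    [/\ I0 \subset S, #|I0|%:R <= d &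
      let E0 := \bigcup_(alpha in I0) alpha in
      #|[set alpha in S | alpha \subset graph_at w i :\: E0]|%:R <= mu' + k].

(* (1 + k / mu')^(-d). When mu' = 0, i.e. S is empty, k / mu' is +oo and the
   value is 0; it must be given separately because k / 0 = 0 in R. *)
Definition deletion_bound (R : realType) (mu' d k : R) : R :=
  if mu' == 0 then 0 else (1 + k / mu') `^ (- d).

(* Main.v *)
(* Rödl–Ruciński deletion.  When DL fails, edge-disjoint members of S inside
   G(m) can be chosen greedily: after at most d choices more than mu' + k
   members of S avoid all edges used so far.  With z > d choices this yields
   more than (mu' + k)^z sequences, whereas the expected number of sequences of
   z edge-disjoint members is at most mu'^z, as such a sequence uses exactly
   l z edges.  Markov's inequality bounds the probability by
   (1 + k / mu')^(-z). *)
Require Import Defs.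
From mathcomp Require Import all_boot all_order all_algebra.
From mathcomp Require Import all_classical all_reals all_analysis.
From mathcomp Require Import ring.
Import Order.TTheory GRing.Theory Num.Theory.
Local Open Scope ring_scope.

(** One greedy choice, with [F] the edges used so far. After exchanging the sums on the right, each
    [w] on the left is counted once for every [a] in [S] that lies in [G w] and avoids [F], so at
    least [c] times. *)
Lemma sum_deletion_step (R : realDomainType) (T E : finType) (P : T -> R)
    (G : T -> {set E}) (B : pred T) (S : {set {set E}}) (F : {set E}) (c : R) :
  (forall w, 0 <= P w) ->
  (forall w, B w -> c <= #|[set a in S | a \subset G w :\: F]|%:R) ->
  c * (\sum_(w | B w && (F \subset G w)) P w) <=
  \sum_(a in S | [disjoint a & F])
    \sum_(w | B w && (F :|: a \subset G w)) P w.
Proof.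
move=> P0 Bc.
rewrite (exchange_big_dep (fun w => B w && (F \subset G w))) /=; last first.
  by move=> a w _ /andP[-> /=]; rewrite finset.subUset => /andP[].
rewrite mulr_sumr; apply: ler_sum => w /andP[Bw FG].
rewrite sumr_const -mulr_natl; apply: ler_wpM2r => //.
apply: le_trans (Bc w Bw) _; rewrite ler_nat subset_leq_card //.
apply/fintype.subsetP => a; rewrite !inE finset.subsetD => /and3P[aS aG aF].
by rewrite unfold_in /= aS aF Bw finset.subUset FG aG.
Qed.

(** Starting from no chosen members, [r.+1] greedy choices each gain a factor [c] on the left and
    cost a factor [#|S| * x ^+ l] on the right. Here [B] is the bad event and [x] the price of one
    edge. *)
Lemma sum_deletion (R : realDomainType) (T E : finType) (P : T -> R)
    (G : T -> {set E}) (B : pred T) (S : {set {set E}}) (l r : nat) (x c : R) :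
  0 <= x -> 0 <= c -> (forall w, 0 <= P w) ->
  (forall F : {set E}, F \subset finset.cover S ->
     \sum_(w | B w && (F \subset G w)) P w <= x ^+ #|F|) ->
  (forall a, a \in S -> #|a| = l) ->
  (forall w (I : {set {set E}}), B w -> I \subset S -> (#|I| <= r)%N ->
     c <= #|[set a in S | a \subset G w :\: finset.cover I]|%:R) ->
  c ^+ r.+1 * (\sum_(w | B w) P w) <= (#|S|%:R * x ^+ l) ^+ r.+1.
Proof.
move=> x0 c0 P0 PF Sl Bc.
(* [I] holds the members chosen so far and [j] counts the choices still to come. The order of the
   choices is forgotten, since only their union matters. *)
suff main j (I : {set {set E}}) : I \subset S -> (#|I| + j <= r.+1)%N ->
    c ^+ j * (\sum_(w | B w && (finset.cover I \subset G w)) P w) <=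
    x ^+ #|finset.cover I| * (#|S|%:R * x ^+ l) ^+ j.
  have := main r.+1 finset.set0 (finset.sub0set S).
  rewrite cards0 => /(_ (leqnn _)).
  rewrite /finset.cover big_set0 cards0 expr0 mul1r.
  by under eq_bigl do rewrite finset.sub0set andbT.
elim: j I => [|j IHj] I IS Ij.
  rewrite !expr0 mul1r mulr1; apply: PF.
  by apply/finset.bigcupsP => a aI;
    apply: finset.bigcup_sup (fintype.subsetP IS a aI).
(* With at least one choice left, [#|I| <= r], so deleting the edges of [I] still leaves [c]
   members. *)
have Bc' w : B w -> c <= #|[set a in S | a \subset G w :\: finset.cover I]|%:R.
  by move=> Bw; apply: Bc => //; rewrite -ltnS (leq_trans _ Ij)//
    addnS ltnS leq_addr.
rewrite exprSr -mulrA.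
apply: le_trans (ler_wpM2l (exprn_ge0 j c0)
  (sum_deletion_step _ _ _ _ _ _ _ _ _ P0 Bc')) _.
rewrite mulr_sumr.
have bnd a : (a \in S) && [disjoint a & finset.cover I] ->
    c ^+ j * (\sum_(w | B w && (finset.cover I :|: a \subset G w)) P w) <=
    x ^+ #|finset.cover I| * x ^+ l * (#|S|%:R * x ^+ l) ^+ j.
  move=> /andP[aS aI].
  have caI : finset.cover (a |: I) = finset.cover I :|: a.
    by rewrite /finset.cover finset.bigcup_setU big_set1 finset.setUC.
  (* Disjointness makes the new member cost exactly [l] further edges, that is a factor [x ^+ l]. *)
  have cardU : #|finset.cover I :|: a| = (#|finset.cover I| + l)%N.
    by rewrite cardsU finset.setIC (finset.disjoint_setI0 aI) cards0
      subn0 (Sl a aS) addnC.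
  rewrite -caI -exprD -cardU -caI; apply: IHj.
    by rewrite finset.subUset finset.sub1set aS.
  (* An empty [a] may already lie in [I], so the size of [a |: I] is only bounded above. *)
  by rewrite (leq_trans _ Ij)// addnS -addSn leq_add2r cardsU1
    -add1n leq_add2r leq_b1.
apply: le_trans (ler_sum _ bnd) _.
set y := _ ^+ #|_| * _ * _.
have y0 : 0 <= y by rewrite !mulr_ge0 ?exprn_ge0 ?mulr_ge0 ?exprn_ge0.
(* Dropping the disjointness condition leaves [#|S|] equal terms. *)
apply: (@le_trans _ _ (\sum_(a in S) y)).
  rewrite big_mkcondr; apply: ler_sum => a _; by case: ifP.
rewrite sumr_const -(mulr_natl y) /y exprSr.
by rewrite le_eqVlt; apply/orP; left; apply/eqP; ring.
Qed.

Lemma trajectory_prob_ge0 (R : realType) (n m : nat) (w : trajectory n m) :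
  0 <= trajectory_prob R w.
Proof.
apply: prodr_ge0 => i _; rewrite /step_prob; case: (tnth w i) => [e|].
  by case: ifP => // _; rewrite invr_ge0.
by case: ifP.
Qed.

Lemma deletion_bound_expR (R : realType) (a d k : R) :
  0 <= a -> 0 < d -> 0 < k ->
  deletion_bound a d k <= expR (- (d * k / (a + k))).
Proof.
move=> a0 d0 k0; rewrite /deletion_bound; case: eqP => [_|/eqP aN0].
  exact: expR_ge0.
have {aN0}a_gt0 : 0 < a by rewrite lt_neqAle eq_sym aN0.
have q0 : 0 < 1 + k / a by rewrite addr_gt0 ?divr_gt0.
rewrite /powR gt_eqF // ler_expR mulNr lerN2 -mulrA ler_pM2l //.
(* ln y >= 1 - 1 / y, at y = 1 + k / a *)
have := @le_ln1Dx R (- (k / (a + k))).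
have -> : 1 - k / (a + k) = (1 + k / a)^-1.
  by field; rewrite !gt_eqF ?addr_gt0.
rewrite lnV ?posrE // lerN2; apply.
by rewrite ltrN2 ltr_pdivrMr ?addr_gt0 // mul1r ltrDr.
Qed.

(** Dividing by [(a + k) ^+ r.+1] gives the power of [1 + k / a] with exponent [- r.+1]. As this
    base is at least 1, the exponent may be raised to [- d]. For [a = 0] the hypothesis forces
    [y <= 0]. *)
Lemma le_deletion_bound (R : realType) (a d k y : R) (r : nat) :
  0 <= a -> 0 < k -> d <= r.+1%:R ->
  (a + k) ^+ r.+1 * y <= a ^+ r.+1 -> y <= deletion_bound a d k.
Proof.
move=> a0 k0 dr; have ak0 : 0 < a + k by rewrite ltr_wpDl.
rewrite -ler_pdivlMl ?exprn_gt0 // => /le_trans; apply.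
rewrite /deletion_bound; case: eqP => [->|/eqP aN0].
  by rewrite expr0n /= mulr0.
have {aN0}a_gt0 : 0 < a by rewrite lt_neqAle eq_sym aN0.
have q0 : 0 < 1 + k / a by rewrite addr_gt0 ?divr_gt0.
have -> : ((a + k) ^+ r.+1)^-1 * a ^+ r.+1 = (1 + k / a) `^ (- r.+1%:R).
  rewrite powRN powR_mulrn ?ltW // -!exprVn -exprMn; congr (_ ^+ _).
  by field; rewrite !gt_eqF.
apply: ler_powR; last by rewrite lerN2.
by rewrite lerDl divr_ge0 ?ltW.
Qed.

Theorem lemma4p5 (R : realType)
  (W eps0 mu : R) (hW0 : 0 < W) (heps0 : 0 < eps0) (hmu : 0 < mu)
  (hW : 500 <= W) (heps0' : eps0 <= 1 / 1000)
  (hWmu : 2 * W * mu ^+ 5 <= eps0)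
  (n m : nat) (hm : `|m%:R - n%:R ^+ 2 * p_ R n * tmax mu n| < 1)
  (eps : R) (heps : 0 < eps)
  (hF : forall F : {set vpair n}, F \subset pairs n ->
     Pr R (fun w : trajectory n m =>
             good W eps0 mu m w /\ F \subset graph_at w m)
       <= (p_ R n * n%:R `^ (2 * eps)) ^+ #|F|)
  (l : nat) (hl : (1 <= l)%N)
  (S : {set {set vpair n}})
  (hS : forall alpha, alpha \in S -> alpha \subset pairs n /\ #|alpha| = l)
  (d k : R) (hd : 0 < d) (hk : 0 < k) :
  let mu' := #|S|%:R * p_ R n ^+ l * n%:R `^ (2 * l%:R * eps) in
  Pr R (fun w : trajectory n m =>
          good W eps0 mu m w /\ ~ DL S mu' m d k w)
    <= deletion_bound mu' d k /\
  deletion_bound mu' d k <= expR (- (d * k / (mu' + k))).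
Proof.
move=> mu'.
have mu'0 : 0 <= mu' by rewrite !mulr_ge0 ?exprn_ge0 ?powR_ge0.
split; last exact: deletion_bound_expR.
(* With [r] the integer part of [d], any [r] members are an admissible deletion in [DL], while the
   exponent [r.+1] exceeds [d]. *)
apply: (@le_deletion_bound _ _ _ _ _ (Num.truncn d)) => //.
  by rewrite ltW // truncnS_gt.
set x := p_ R n * n%:R `^ (2 * eps).
have mu'E : mu' = #|S|%:R * x ^+ l.
  rewrite /mu' /x exprMn mulrA; congr (_ * _).
  by rewrite -powR_mulrn ?powR_ge0 // -powRrM mulrAC.
rewrite [in leRHS]mu'E /Pr.
apply: (@sum_deletion _ _ _ _ (fun w : trajectory n m => graph_at w m)).
- by rewrite mulr_ge0 ?powR_ge0.
- by rewrite addr_ge0 // ltW.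
- exact: trajectory_prob_ge0.
- move=> F FS; apply: le_trans (hF F _); last first.
    apply: fintype.subset_trans FS _; apply/finset.bigcupsP => a /hS[aP _].
    exact: aP.
  rewrite /Pr big_mkcond [leRHS]big_mkcond; apply: ler_sum => w _.
  case: ifP => [/andP[/asboolP[gw _] Fw]|_].
    by rewrite asboolT.
  by case: ifP => // _; exact: trajectory_prob_ge0.
- by move=> a /hS[].
(* If at most [mu' + k] members survived the deletion of the edges of [I], then [I] itself would
   witness [DL]. *)
- move=> w I /asboolP[_ nDL] IS Id; rewrite leNgt; apply/negP => lt.
  apply: nDL; exists I; split => //; last exact: ltW.
  apply: (@le_trans _ _ (Num.truncn d)%:R); first by rewrite ler_nat.
  by rewrite truncn_le ltW.
Qed.
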